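(* Let $0<q<1$, let $\mathcal{H}=\{s_{m+n}\}_{m,n\ge0}$ with $s_n=q^{-n^2/2}$, and let $\mathcal{A}=\{a_{j,k}\}_{j,k\ge0}$ be the coefficient matrix of the reproducing kernel of this indeterminate moment problem. There are symmetric infinite matrices $\widetilde{\mathcal{A}}$ different from $\mathcal{A}$ which satisfy $\widetilde{\mathcal{A}}\mathcal{H}=\mathcal{I}$, where $\mathcal{I}$ is the infinite identity matrix and the product is defined by absolutely convergent series.
   Context: The numbers $s_n=q^{-n^2/2}$ are the moments of the measure on $(0,\infty)$ with density $\frac{w_q(x)}{x}$, where $w_q(x)=\frac{1}{\sqrt{2\pi\log(1/q)}}\exp\big(-\frac{(\log x)^2}{2\log(1/q)}\big)$; the moment problem is indeterminate (more than one measure has these moments). Let $(P_n)$ be the orthonormal polynomials (positive leading coefficients up to the irrelevant sign). The reproducing kernel $K(z,w)=\sum_{n=0}^\infty P_n(z)P_n(w)$ is an entire function of two variables and $\mathcal{A}=\{a_{j,k}\}$ is defined by $K(z,w)=\sum_{j,k\ge0}a_{j,k}z^jw^k$. For infinite matrices $\mathcal{X}=\{x_{i,k}\}$, the equation $\mathcal{X}\mathcal{H}=\mathcal{I}$ with absolutely convergent product means that for all $i,j\ge0$ one has $\sum_{k}|x_{i,k}s_{k+j}|<\infty$ and $\sum_{k}x_{i,k}s_{k+j}=\delta_{i,j}$. *)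

(* Defs.v *)
From HB Require Import structures.
From mathcomp Require Import all_boot all_order all_algebra.
From mathcomp Require Import complex.
From mathcomp Require Import all_classical all_reals all_analysis.

Set Implicit Arguments.
Unset Strict Implicit.
Unset Printing Implicit Defensive.

Import Order.TTheory GRing.Theory Num.Theory.
Import numFieldNormedType.Exports.

Local Open Scope classical_set_scope.
Local Open Scope complex_scope.
Local Open Scope ring_scope.

Definition sw_moment (R : realType) (q : R) (n : nat) : R :=
  q `^ (- (n%:R ^+ 2 / 2)).

Definition hankel (R : realType) (s : nat -> R) (m n : nat) : R := s (m + n)%N.

Definition sw_weight (R : realType) (q x : R) : R :=
  (Num.sqrt (2 * pi * ln q^-1))^-1 * expR (- ((ln x) ^+ 2 / (2 * ln q^-1))).

(* [sw_weight q x / x] is the density on (0, +oo) of a measure whose n-th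
   moment is [sw_moment q n]; as orthonormality only involves moments, any other
   measure with these moments has the same orthonormal polynomials. *)
Definition sw_orthonormal (R : realType) (q : R) (P : nat -> {poly R}) : Prop :=
  (forall n, size (P n) = n.+1 /\ 0 < lead_coef (P n)) /\
  (forall m n,
    (\int[lebesgue_measure]_(x in `]0%R, +oo[)
       ((P m).[x] * (P n).[x] * (sw_weight q x / x))%:E)%E
    = ((m == n)%:R)%:E).

Definition poly_complex (R : realType) (p : {poly R}) : {poly R[i]} :=
  map_poly (real_complex R) p.

(* [R[i]^o] is [R[i]] with the topology of its modulus. *)
Definition is_reproducing_kernel (R : realType) (P : nat -> {poly R})
    (K : R[i] -> R[i] -> R[i]) : Prop :=
  forall z w : R[i],
    series (fun n =>
        (poly_complex (P n)).[z] * (poly_complex (P n)).[w] : R[i]^o) @ \oo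
      --> (K z w : R[i]^o).

(* The double power series converges absolutely on C^2, so its sum does not
   depend on the order of summation and may be taken along squares. *)
Definition power_series_coefs (R : realType) (K : R[i] -> R[i] -> R[i])
    (a : nat -> nat -> R) : Prop :=
  forall z w : R[i],
    esum.summable [set: nat * nat]
      (fun p => (ComplexField.Normc.normc
        ((a p.1 p.2)%:C * z ^+ p.1 * w ^+ p.2))%:E) /\
    (fun N : nat =>
        \sum_(j < N) \sum_(k < N) (a j k)%:C * z ^+ j * w ^+ k : R[i]^o) @ \oo
      --> (K z w : R[i]^o).

Definition mx_symmetric (R : realType) (X : nat -> nat -> R) : Prop :=
  forall i j, X i j = X j i.

(* X Y = I, every entry of the product being an absolutely convergent series. *)
Definition abs_mul_eq_id (R : realType) (X Y : nat -> nat -> R) : Prop :=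
  forall i j : nat,
    cvgn [normed series (fun k => X i k * Y k j)] /\
    series (fun k => X i k * Y k j) @ \oo --> ((i == j)%:R : R).

(* Main.v *)
Require Import Defs.
From mathcomp Require Import all_boot all_order all_algebra.
From mathcomp Require Import complex.
From mathcomp Require Import all_classical all_reals all_analysis.
From mathcomp Require Import ring lra.
Local Open Scope ring_scope.
Set Implicit Arguments.
Unset Strict Implicit.
Unset Printing Implicit Defensive.
Import Order.TTheory GRing.Theory Num.Theory.
Import numFieldNormedType.Exports.
Local Open Scope classical_set_scope.

(** Let [f z = \sum_k phi_k z^k] be the entire function with [f z = (1 - z) f (q z)],
    that is [f z = \prod_(n >= 0) (1 - q^n z)]; it vanishes at every [q^-j].
    Since [s_(k+j) = s_k s_j q^(-jk)], a matrix [Y i k / (s_i s_k)] is a left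
    inverse of [H] as soon as the row functions [\sum_k Y i k z^k] take the value
    [delta_ij] at [z = q^-j].  A symmetric such [Y] is [T / f q], where [T] comes
    from [T 0 k = q^k phi_k] and [T (i+1) k = q^k (T i k + phi_(i+1) phi_k)].  Because
    [f (q^-j) = 0], adding [phi_i phi_k] to [Y] gives a second one, and
    at most one of the two yields the coefficient matrix of the kernel. *)

(** Euler's coefficients (-1)^n q^(n(n-1)/2) / ((1 - q) ... (1 - q^n)), given by their successive
    ratios. *)
Fixpoint euler_coef (R : realType) (q : R) (n : nat) : R :=
  if n is k.+1 then - q ^+ k / (1 - q ^+ k.+1) * euler_coef q k else 1.

(** Unfolded, entry (i, k) is phi_k times the sum over j <= i of q^(k(i-j+1)) phi_j, a form that
    hides the symmetry. *)
Fixpoint inv_kernel (R : realType) (q : R) (i k : nat) : R :=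
  if i is j.+1
  then q ^+ k * (inv_kernel q j k + euler_coef q j.+1 * euler_coef q k)
  else q ^+ k * euler_coef q k.

Section EulerCoef.
Variables (R : realType) (q : R).
Hypotheses (hq0 : 0 < q) (hq1 : q < 1).

Local Notation phi := (euler_coef q).
Local Notation T := (inv_kernel q).

(** * Recurrences and symmetry of the coefficients *)

Lemma subr1_expS_gt0 n : 0 < 1 - q ^+ n.+1.
Proof. by rewrite subr_gt0 exprn_ilt1 // ltW. Qed.

(** This is f(z) = (1 - z) f(q z) read off at z^(n+1). *)
Lemma euler_coefS n : q ^+ n.+1 * phi n.+1 = phi n.+1 + q ^+ n * phi n.
Proof.
have h := lt0r_neq0 (subr1_expS_gt0 n).
by rewrite [phi n.+1]/=; field.
Qed.

(** The mirror image of the defining recurrence, with the two indices exchanged; symmetry follows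
    from it by induction. *)
Lemma inv_kernelSr i k : T i k.+1 = q ^+ i * (T i k + phi i * phi k.+1).
Proof.
elim: i k => [|i IHi] k; first by rewrite /= -/(phi k.+1) !expr0 euler_coefS; ring.
have -> : T i.+1 k.+1 = q ^+ k.+1 * (T i k.+1 + phi i.+1 * phi k.+1) by [].
have -> : T i.+1 k = q ^+ k * (T i k + phi i.+1 * phi k) by [].
rewrite IHi.
have h1 := euler_coefS i; have h2 := euler_coefS k.
(* Using [euler_coefS] at i on the left and at k on the right, both sides become q^(i+1) q^k T_(i,k)
   + q^(i+1) phi_(i+1) q^(k+1) phi_(k+1). *)
have -> : q ^+ k.+1 * (q ^+ i * (T i k + phi i * phi k.+1) + phi i.+1 * phi k.+1)
  = q ^+ i.+1 * q ^+ k * T i k + q ^+ k.+1 * phi k.+1 * (phi i.+1 + q ^+ i * phi i).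
  by rewrite !exprS; ring.
rewrite -h1.
have -> : q ^+ i.+1 * (q ^+ k * (T i k + phi i.+1 * phi k) + phi i.+1 * phi k.+1)
  = q ^+ i.+1 * q ^+ k * T i k + q ^+ i.+1 * phi i.+1 * (phi k.+1 + q ^+ k * phi k).
  by ring.
by rewrite -h2; ring.
Qed.

Lemma inv_kernelr0 i : T i 0 = q ^+ i * phi i.
Proof.
elim: i => [//|i IHi].
by rewrite euler_coefS [LHS]/= -/(phi i.+1) IHi expr0; ring.
Qed.

Lemma inv_kernel_sym i k : T i k = T k i.
Proof.
elim: k i => [|k IHk] i; first exact: inv_kernelr0.
by rewrite inv_kernelSr IHk /= -/(phi k.+1); ring.
Qed.

(** * Absolute convergence of the row series *)

Lemma inv_kernel_bound i : exists M : R, forall k, `|T i k| <= M * `|phi k|.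
Proof.
have qk1 k : `|q ^+ k| <= 1.
  by rewrite normrX exprn_ile1 ?normr_ge0// gtr0_norm// ltW.
elim: i => [|i [M IHM]].
  by exists 1 => k /=; rewrite normrM ler_wpM2r.
exists (M + `|phi i.+1|) => k; rewrite [T _ _]/= -/(phi i.+1) normrM.
rewrite -[leRHS]mul1r ler_pM// (le_trans (ler_normD _ _))// mulrDl normrM.
by rewrite lerD2r.
Qed.

(** Ratio test: q^k |z| / (1 - q^(k+1)) tends to 0, so [b k] is eventually nonincreasing, hence
    bounded. *)
Lemma euler_coef_geometric_bound (z : R) :
  exists M : R, forall k, `|phi k * z ^+ k| <= geometric M 2^-1 k.
Proof.
pose b k := `|phi k * z ^+ k| * 2 ^+ k.
have b0 k : 0 <= b k by rewrite mulr_ge0 ?exprn_ge0.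
(* Once q^k < c, one has 2 q^k |z| <= 1 - q <= 1 - q^(k+1), so the ratio of [b] is at most 1. The
   added 1 keeps the denominator positive at z = 0. *)
pose c := (1 - q) / (2 * (`|z| + 1)).
have z1 : 0 < `|z| + 1 by rewrite ltr_wpDl.
have c0 : 0 < c by rewrite divr_gt0 ?subr_gt0// mulr_gt0.
have [N _ hN] : \forall k \near \oo, q ^+ k < c.
  have := @cvg_expr R q; rewrite gtr0_norm// => /(_ hq1).
  move/cvgr_lt; exact.
have bS k : (N <= k)%N -> b k.+1 <= b k.
  move=> /hN /= hk.
  rewrite /b [phi k.+1]/= !exprS !normrM normrN.
  have q1 : 0 < 1 - q * q ^+ k by rewrite -exprS subr1_expS_gt0.
  rewrite normrV ?unitfE ?gt_eqF// (gtr0_norm q1).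
  rewrite (_ : `|q ^+ k| = q ^+ k); last by rewrite gtr0_norm// exprn_gt0.
  set x := q ^+ k in hk q1 *.
  have x1 : x <= 1 by rewrite exprn_ile1 ?ltW.
  have hx : x / (1 - q * x) * (`|z| * 2) <= 1.
    rewrite mulrAC ler_pdivrMr// mul1r.
    have : x * (`|z| * 2) <= 1 - q.
      move: hk; rewrite /c ltr_pdivlMr ?mulr_gt0// => hk.
      have x0 : 0 < x by rewrite exprn_gt0.
      have := normr_ge0 z.
      by nra.
    have : q * x <= q by rewrite ler_piMr// ltW.
    by lra.
  rewrite [leLHS](_ : _ = (x / (1 - q * x) * (`|z| * 2)) * (`|phi k| * `|z ^+ k| * 2 ^+ k)); last by ring.
  by rewrite ler_piMl// !mulr_ge0// exprn_ge0.
(* The sum of the first N+1 nonnegative values stands in for their maximum. *)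
have bM k : b k <= \sum_(i < N.+1) b i.
  have small j : (j <= N)%N -> b j <= \sum_(i < N.+1) b i.
    move=> jN; rewrite (bigD1 (Ordinal (jN : (j < N.+1)%N)))//= lerDl.
    by rewrite sumr_ge0.
  elim: k => [|k IHk]; first exact: small.
  by have [/small//|/bS h] := leqP k.+1 N; exact: le_trans h _.
exists (\sum_(i < N.+1) b i) => k.
rewrite /geometric /= exprVn ler_pdivlMr ?exprn_gt0//; exact: bM.
Qed.

Lemma cvg_normed_euler (z : R) : cvgn [normed series (fun k => phi k * z ^+ k)].
Proof.
have [M hM] := euler_coef_geometric_bound z.
apply: (series_le_cvg _ _ hM) => //.
- by move=> k; exact: le_trans (hM k).
- by apply: is_cvg_geometric_series; rewrite ger0_norm ?invf_lt1//; lra.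
Qed.

Lemma cvg_normed_inv_kernel i (z : R) :
  cvgn [normed series (fun k => T i k * z ^+ k)].
Proof.
have [M hM] := inv_kernel_bound i.
have le k : `|T i k * z ^+ k| <= M * `|phi k * z ^+ k|.
  by rewrite !normrM mulrA ler_wpM2r.
apply: (series_le_cvg _ _ le) => //.
- by move=> k; exact: le_trans (le k).
- by apply: (@is_cvg_seriesZ R _ M); exact: cvg_normed_euler.
Qed.

(** * The function f: functional equation, zeros, and f(q) <> 0 *)

Definition euler_fun (z : R) : R := limn (series (fun k => phi k * z ^+ k)).
Definition kernel_fun i (z : R) : R := limn (series (fun k => T i k * z ^+ k)).

Lemma cvg_euler_fun z : series (fun k => phi k * z ^+ k) @ \oo --> euler_fun z.
Proof. exact/normed_cvg/cvg_normed_euler. Qed.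

Lemma cvg_kernel_fun i z :
  series (fun k => T i k * z ^+ k) @ \oo --> kernel_fun i z.
Proof. exact/normed_cvg/cvg_normed_inv_kernel. Qed.

Lemma euler_funM z : euler_fun z = (1 - z) * euler_fun (q * z).
Proof.
pose s z := series (fun k => phi k * z ^+ k).
(* The functional equation is exact on partial sums, provided the one multiplied by z is one term
   shorter. *)
have e n : s z n.+1 = s (q * z) n.+1 - z * s (q * z) n.
  rewrite /s; elim: n => [|n IHn].
    by rewrite !seriesSr /series /= !big_geq//= !expr0; ring.
  rewrite seriesSr [in RHS]seriesSr [X in z * X]seriesSr IHn.
  have -> : phi n.+1 * (q * z) ^+ n.+1 = (phi n.+1 + q ^+ n * phi n) * z ^+ n.+1.
    by rewrite -euler_coefS exprMn; ring.
  by rewrite exprMn exprS; ring.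
suff c : s z @ \oo --> (1 - z) * euler_fun (q * z) by exact: cvg_lim c.
rewrite -cvg_shiftS /=; under eq_fun do rewrite e.
rewrite mulrBl mul1r; apply: cvgB; last first.
  by apply: cvgMr; exact: cvg_euler_fun.
by rewrite (cvg_shiftS (s (q * z))); exact: cvg_euler_fun.
Qed.

Lemma euler_fun_Vexp j : euler_fun (q^-1 ^+ j) = 0.
Proof.
elim: j => [|j IHj]; first by rewrite euler_funM subrr mul0r.
by rewrite euler_funM exprS mulVKf ?lt0r_neq0// IHj mulr0.
Qed.

(** A quantitative form of continuity at 0, where f is 1: with M the sum of the |phi_k|, every
    nonconstant term carries a factor at most q^n. *)
Lemma euler_fun_near0 : exists M : R, forall n, `|1 - euler_fun (q ^+ n)| <= q ^+ n * M.
Proof.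
exists (limn [normed series (fun k => phi k * 1 ^+ k)]) => n.
set M := limn _.
pose s := series (fun k => phi k * (q ^+ n) ^+ k).
(* The shift guarantees that the constant term phi_0 = 1 is present and cancels. *)
have c : (fun m => `|1 - s m.+1|) @ \oo --> `|1 - euler_fun (q ^+ n)|.
  apply: cvg_norm; apply: cvgB; first exact: cvg_cst.
  by rewrite (cvg_shiftS s); exact: cvg_euler_fun.
rewrite -(cvg_lim _ c)//; apply: limr_le; first by apply/cvg_ex; eexists; exact: c.
apply: nearW => m.
have sE : s m.+1 = 1 + \sum_(0 <= k < m) phi k.+1 * (q ^+ n) ^+ k.+1.
  by rewrite /s /series /= big_nat_recl// expr0 mulr1.
have sM : [normed series (fun k => phi k * 1 ^+ k)] m.+1 <= M.
  apply: nondecreasing_cvgn_le; last exact: cvg_normed_euler.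
  by apply: (@nondecreasing_series _ _ xpredT) => k _ _ /=.
rewrite sE opprD addNKr normrN.
apply: le_trans (ler_norm_sum _ _ _) _.
have qn0 : 0 <= q ^+ n by rewrite exprn_ge0// ltW.
apply: le_trans (ler_wpM2l qn0 sM).
rewrite /= /series /= big_nat_recl// mulrDr mulr_sumr.
apply: ler_wpDl; first by rewrite mulr_ge0.
apply: ler_sum => k _.
rewrite expr1n mulr1 normrM mulrC ler_wpM2r// exprS normrM ger0_norm//.
by rewrite ler_piMr// normrX exprn_ile1// ger0_norm// exprn_ile1// ltW.
Qed.

(** If f(q) = 0, dividing by 1 - q^n repeatedly gives f(q^n) = 0 for all n >= 1, against f(q^n) ->
    1. *)
Lemma euler_fun_q_neq0 : euler_fun q != 0.
Proof.
apply/eqP => f0.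
have fn n : euler_fun (q ^+ n.+1) = 0.
  elim: n => [//|n IHn]; have := euler_funM (q ^+ n.+1).
  rewrite IHn -exprS => /esym/eqP.
  by rewrite mulf_eq0 gt_eqF ?subr1_expS_gt0//= => /eqP.
have [M hM] := euler_fun_near0.
have c : q ^+ n * M @[n --> \oo] --> (0 * M : R).
  by apply: cvgMl; apply: cvg_expr; rewrite gtr0_norm.
have : \forall n \near \oo, q ^+ n * M < 1.
  by move/cvgr_lt : c; apply; rewrite mul0r.
case=> N _ /(_ N.+1 (leqnSn N)) /=.
by have := hM N.+1; rewrite fn subr0 normr1 => h /(le_lt_trans h); rewrite ltxx.
Qed.

(** * Values of the row functions at the points q^-j *)

Lemma kernel_fun0 z : kernel_fun 0 z = euler_fun (q * z).
Proof.
rewrite /kernel_fun /euler_fun; congr (limn (series _)).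
by apply/funext => k; rewrite /= exprMn; ring.
Qed.

Lemma kernel_funS i z :
  kernel_fun i.+1 z = kernel_fun i (q * z) + phi i.+1 * euler_fun (q * z).
Proof.
apply: (cvg_lim (@Rhausdorff R)).
rewrite (_ : (fun k => _) = (fun k => T i k * (q * z) ^+ k)
    + phi i.+1 *: (fun k => phi k * (q * z) ^+ k)); last first.
  by apply/funext => k; rewrite !fctE /= -/(phi i.+1) exprMn /GRing.scale /=; ring.
rewrite seriesD seriesZ; apply: cvgD; first exact: cvg_kernel_fun.
by apply: cvgZr; exact: cvg_euler_fun.
Qed.

(** At z = 1 the column recurrence [inv_kernelSr] sums to g = q^(i+1) (g + phi_(i+1) f(1)); since
    f(1) = 0 and q^(i+1) <> 1, g vanishes. *)
Lemma kernel_funS1 i : kernel_fun i.+1 1 = 0.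
Proof.
pose t := series (fun k => T i.+1 k * 1 ^+ k).
pose s := series (fun k => phi k * 1 ^+ k).
have e n : t n.+1 = q ^+ i.+1 * (t n + phi i.+1 * s n.+1).
  rewrite /t /s; elim: n => [|n IHn].
    rewrite !seriesSr /series /= !big_geq//= -/(phi i.+1) -[RHS]/(_ * _).
    have := inv_kernelr0 i.+1; rewrite [T _ _]/= -/(phi i.+1) => ->.
    by rewrite !expr0; ring.
  rewrite [LHS]seriesSr [in RHS]seriesSr [in RHS]seriesSr.
  rewrite [X in X + _]IHn inv_kernelSr !seriesSr !expr1n; ring.
have : kernel_fun i.+1 1 = q ^+ i.+1 * (kernel_fun i.+1 1 + phi i.+1 * euler_fun 1).
  suff c : t @ \oo --> q ^+ i.+1 * (kernel_fun i.+1 1 + phi i.+1 * euler_fun 1).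
    by rewrite {1}/kernel_fun (cvg_lim (@Rhausdorff R) c).
  rewrite -cvg_shiftS /=; under eq_fun do rewrite e.
  apply: cvgMr; apply: cvgD; first exact: cvg_kernel_fun.
  by apply: cvgMr; rewrite (cvg_shiftS s); exact: cvg_euler_fun.
have := euler_fun_Vexp 0; rewrite expr0 => ->.
rewrite mulr0 addr0 => /eqP; rewrite -subr_eq0 -{1}[kernel_fun _ _]mul1r -mulrBl.
by rewrite mulf_eq0 gt_eqF ?subr1_expS_gt0//= => /eqP.
Qed.

(** As f vanishes at q^-j, [kernel_funS] lowers i and j together until one of them is 0. *)
Lemma kernel_fun_Vexp i j :
  kernel_fun i (q^-1 ^+ j) = euler_fun q * (i == j)%:R.
Proof.
elim: i j => [|i IHi] [|j].
- by rewrite kernel_fun0 expr0 !mulr1.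
- by rewrite kernel_fun0 exprS mulVKf ?lt0r_neq0// euler_fun_Vexp mulr0.
- by rewrite expr0 kernel_funS1 mulr0.
- by rewrite kernel_funS exprS mulVKf ?lt0r_neq0// IHi euler_fun_Vexp mulr0 addr0.
Qed.

(** * From row functions to left inverses of the Hankel matrix *)

Lemma sw_moment_gt0 n : 0 < sw_moment q n.
Proof. exact: powR_gt0. Qed.

Lemma sw_momentD k j :
  sw_moment q (k + j) = sw_moment q k * sw_moment q j * (q^-1 ^+ j) ^+ k.
Proof.
rewrite /sw_moment -exprM exprVn -(powR_mulrn (j * k) (ltW hq0)) -powRN.
have h a b : q `^ (a + b) = q `^ a * q `^ b.
  by rewrite powRD// lt0r_neq0 ?implybT.
by rewrite -!h natrD natrM; congr (_ `^ _); field.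
Qed.

End EulerCoef.

(** Pairing row i with column j of the Hankel matrix evaluates the row function at q^-j, times s_j /
    s_i; this factor is 1 on the diagonal and multiplies 0 elsewhere. *)
Lemma abs_mul_eq_id_sw (R : realType) (q : R) (hq0 : 0 < q)
    (Y : nat -> nat -> R) (F : nat -> R -> R) :
  (forall i z, cvgn [normed series (fun k => Y i k * z ^+ k)]) ->
  (forall i z, series (fun k => Y i k * z ^+ k) @ \oo --> F i z) ->
  (forall i j, F i (q^-1 ^+ j) = (i == j)%:R) ->
  abs_mul_eq_id (fun i k => Y i k / (sw_moment q i * sw_moment q k))
    (hankel (sw_moment q)).
Proof.
move=> cY cF FE i j.
have s0 n : sw_moment q n != 0 by rewrite gt_eqF// sw_moment_gt0.
have -> : (fun k => Y i k / (sw_moment q i * sw_moment q k)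
             * hankel (sw_moment q) k j)
  = (sw_moment q j / sw_moment q i) *: (fun k => Y i k * (q^-1 ^+ j) ^+ k).
  apply/funext => k; rewrite /hankel sw_momentD// fctE /GRing.scale /=.
  by have := s0 i; have := s0 k => *; field; apply/andP.
split.
- set c := _ / _; set u := fun k => _.
  have e : `|c| *: (fun k => `|u k|) = (fun k => `|(c *: u) k|).
    by apply/funext => k; rewrite [RHS]normrM.
  by have := @is_cvg_seriesZ R _ `|c| (cY i (q^-1 ^+ j)); rewrite e.
- have -> : (i == j)%:R = (sw_moment q j / sw_moment q i) *: F i (q^-1 ^+ j).
    rewrite FE /GRing.scale /=; case: eqP => [->|_]; last by rewrite mulr0.
    by rewrite divff// mulr1.
  by rewrite seriesZ; apply: cvgZr; exact: cF.
Qed.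

Theorem mainTheorem12 (R : realType) (q : R) (hq0 : 0 < q) (hq1 : q < 1)
    (P : nat -> {poly R}) (hP : sw_orthonormal q P)
    (K : R[i] -> R[i] -> R[i]) (hK : is_reproducing_kernel P K)
    (A : nat -> nat -> R) (hA : power_series_coefs K A) :
  exists A' : nat -> nat -> R,
    [/\ mx_symmetric A', A' <> A & abs_mul_eq_id A' (hankel (sw_moment q))].
Proof.
pose phi := euler_coef q.
pose C := euler_fun q q.
have C0 : C != 0 by exact: euler_fun_q_neq0.
(* A one-parameter family of solutions: the term in c adds a multiple of f to each row function,
   which changes no value at q^-j. *)
pose Y c i k := inv_kernel q i k / C + c * phi i * phi k.
pose F c i z := kernel_fun q i z / C + c * phi i * euler_fun q z.
pose X c i k := Y c i k / (sw_moment q i * sw_moment q k).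
have YE c i z : (fun k => Y c i k * z ^+ k) =
    C^-1 *: (fun k => inv_kernel q i k * z ^+ k)
    + (c * phi i) *: (fun k => phi k * z ^+ k).
  by apply/funext => k; rewrite !fctE /GRing.scale /= /Y; ring.
have hX c : abs_mul_eq_id (X c) (hankel (sw_moment q)).
  apply: (abs_mul_eq_id_sw hq0 (F := F c)) => i.
  - move=> z.
    have le k : `|Y c i k * z ^+ k| <= `|C^-1| * `|inv_kernel q i k * z ^+ k|
        + `|c * phi i| * `|phi k * z ^+ k|.
      rewrite -!normrM (le_trans _ (ler_normD _ _))//.
      by rewrite /Y mulrDl mulrAC !mulrA [_ * C^-1]mulrC !mulrA.
    apply: (series_le_cvg _ _ le) => //.
    apply: (@is_cvg_seriesD R (`|C^-1| *: (fun k => `|inv_kernel q i k * z ^+ k|))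
        (`|c * phi i| *: (fun k => `|phi k * z ^+ k|))).
        by apply: is_cvg_seriesZ; exact: cvg_normed_inv_kernel.
      by apply: is_cvg_seriesZ; exact: cvg_normed_euler.
  - move=> z; rewrite YE seriesD !seriesZ /F [_ / C]mulrC.
    by apply: cvgD; apply: cvgZr; [exact: cvg_kernel_fun|exact: cvg_euler_fun].
  - move=> j; rewrite /F kernel_fun_Vexp// euler_fun_Vexp// mulr0 addr0.
    by rewrite mulrAC divff// mul1r.
have symX c : mx_symmetric (X c).
  move=> i k; rewrite /X /Y (inv_kernel_sym hq0 hq1 i) (mulrC (sw_moment q i)).
  by congr ((_ + _) / _); ring.
(* If [X 0] happens to be [A], then [X 1] is a different solution: their (0, 0) entries differ by
   phi_0^2 / s_0^2, which is nonzero. *)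
have [X0A|] := pselect (X 0 = A); last by exists (X 0).
exists (X 1); split => // X1A.
have s0 : (sw_moment q 0 * sw_moment q 0)^-1 != 0.
  by rewrite invr_eq0 mulf_neq0// gt_eqF// sw_moment_gt0.
have /(mulIf s0)/addrI/eqP : X 1 0%N 0%N = X 0 0%N 0%N by rewrite X0A X1A.
by rewrite /phi /= !mulr1 oner_eq0.
Qed.
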